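(* Let $s\ge 2$, $t\ge 2$ and $n=s+t$. The graph $K^{s+t}_{n}$ is determined by its $D$-spectrum: every connected graph $D$-cospectral to $K^{s+t}_{n}$ is isomorphic to $K^{s+t}_{n}$.
   Context: All graphs are simple, undirected and connected. For a connected graph $G$, the distance matrix $D(G)$ has as $(i,j)$-entry the distance between the $i$-th and $j$-th vertices; its eigenvalues form the $D$-spectrum of $G$. Two graphs are $D$-cospectral if they have the same $D$-spectrum; $G$ is determined by its $D$-spectrum if every graph $D$-cospectral to $G$ is isomorphic to $G$. $K^{s+t}_{n}$ denotes the graph obtained from disjoint copies of $K_s$ and $K_t$ by adding one edge joining a vertex of $K_s$ to a vertex of $K_t$. *)

(* Defs.v *)
From HB Require Import structures.
From mathcomp Require Import all_boot all_order all_algebra.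
Set Implicit Arguments. Unset Strict Implicit. Unset Printing Implicit Defensive.
Import GRing.Theory Num.Theory.

Definition simple_graph (T : finType) (e : rel T) : Prop :=
  symmetric e /\ irreflexive e.

Definition connected_graph (T : finType) (e : rel T) : Prop :=
  forall x y : T, connect e x y.

Definition walk_len (T : finType) (e : rel T) (x y : T) (k : nat) : bool :=
  [exists p : k.-tuple T, path e x p && (last x p == y)].

(* graph distance: least k such that a walk of length k from x to y exists
   (for connected graphs such k is < #|T|) *)
Definition gdist (T : finType) (e : rel T) (x y : T) : nat :=
  find (walk_len e x y) (iota 0 #|T|).

Definition dist_matrix (m : nat) (e : rel 'I_m) : 'M[int]_m :=
  \matrix_(i, j) Posz (gdist e i j).

(* D-spectrum, i.e. the multiset of eigenvalues of D(G) (with multiplicity),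
   represented by the characteristic polynomial of D(G). *)
Definition D_spectrum (m : nat) (e : rel 'I_m) : {poly int} :=
  char_poly (dist_matrix e).

Definition D_cospectral (m n : nat) (e1 : rel 'I_m) (e2 : rel 'I_n) : Prop :=
  D_spectrum e1 = D_spectrum e2.

Definition graph_iso (m n : nat) (e1 : rel 'I_m) (e2 : rel 'I_n) : Prop :=
  exists f : 'I_m -> 'I_n, bijective f /\ forall x y, e2 (f x) (f y) = e1 x y.

Definition Kst (s t : nat) : rel 'I_(s + t) :=
  fun x y => (x != y) &&
    (((x < s) == (y < s)) ||
     ((val x == 0) && (val y == s)) || ((val x == s) && (val y == 0))).

(* Main.v *)
(* Write A = D(G) + I.  Two vertices have equal rows in A exactly when they are
   closed twins, so a graph is obtained from its twin-free quotient by blowing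
   vertices up into cliques.  The graph K is the blow-up of the path P4 with
   clique sizes (s-1, 1, 1, t-1); its matrix A has rank 4, and the product of the
   four nonzero eigenvalues is (s-1)(t-1) > 0.  If G is D-cospectral to K, the
   spectral theorem gives: every 5x5 principal minor of A vanishes, every 4x4 one is
   nonnegative, and some 4x4 one is nonzero.  The distance matrix of P5 violates
   this, so all distances are at most 3, and a finite search shows that four
   vertices with nonzero minor induce the metric of P4, K13 or C4, and that every
   further vertex is a twin of one of them.  So G is a blow-up of P4, K13 or C4.
   Its characteristic polynomial is then that of a weighted 4x4 matrix, and the
   coefficients leave only the clique sizes (s-1, 1, 1, t-1) on P4, up to
   reversal. *)
From Stdlib Require Import ZArith.
Require Import Defs.
From mathcomp Require Import all_boot all_order all_algebra.
From mathcomp Require Import all_fingroup all_field.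
From mathcomp Require Import zify ssrZ ring.

Set Implicit Arguments. Unset Strict Implicit. Unset Printing Implicit Defensive.
Import Order.TTheory GRing.Theory Num.Theory.
Local Delimit Scope Z_scope with coqZ.
Local Open Scope ring_scope.

(** * Spectrum and principal minors *)

(** Sylvester's identity: the determinant of one block matrix [N] is computed twice, clearing its
    lower left block once from the right by a unipotent factor and once from the left by a factor of
    determinant ['X^k]. *)
Lemma char_poly_mulC (R : idomainType) (n k : nat) (A : 'M[R]_(n, k))
    (B : 'M[R]_(k, n)) :
  'X^k * char_poly (A *m B) = 'X^n * char_poly (B *m A).
Proof.
set Ap := map_mx polyC A; set Bp := map_mx polyC B.
pose N := block_mx ('X%:M : 'M_n) Ap Bp (1%:M : 'M_k).
have e1 : \det N = char_poly (A *m B).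
  have /(congr1 determinant) :
      N *m block_mx 1%:M 0 (- Bp) 1%:M = block_mx ('X%:M - Ap *m Bp) Ap 0 1%:M.
    by rewrite mulmx_block !mulmx1 !mulmx0 !mul1mx add0r mulmxN subrr add0r.
  rewrite det_mulmx det_lblock det_ublock !det1 !mulr1 => ->.
  by rewrite /char_poly /char_poly_mx map_mxM.
have e2 : 'X^k * \det N = 'X^n * char_poly (B *m A).
  have /(congr1 determinant) :
      block_mx 1%:M 0 (- Bp) 'X%:M *m N
        = block_mx ('X%:M) Ap 0 ('X%:M - Bp *m Ap).
    rewrite mulmx_block !mul1mx !mul0mx !addr0 mulNmx scalar_mxC addNr.
    by rewrite mulNmx mulmx1 addrC.
  rewrite det_mulmx det_lblock det_ublock !det_scalar expr1n mul1r => ->.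
  by rewrite /char_poly /char_poly_mx map_mxM.
by rewrite -e1.
Qed.

Lemma char_poly_addr1 (R : comNzRingType) (n : nat) (A : 'M[R]_n) :
  char_poly (A + 1%:M) = char_poly A \Po ('X - 1).
Proof.
rewrite /char_poly -(det_map_mx (comp_poly ('X - 1 : {poly R}))).
congr determinant; apply/matrixP => i j; rewrite !mxE.
rewrite /= comp_polyB comp_polyC rmorphD.
case: eqP => _; rewrite ?mulr1n ?mulr0n ?comp_polyX ?comp_poly0 /=.
  by rewrite rmorph1 opprD addrA addrAC.
by rewrite rmorph0 addr0.
Qed.

Lemma mulXn_inj (F : idomainType) (a b : nat) (p q : {poly F}) :
  p.[0] != 0 -> q.[0] != 0 -> 'X^a * p = 'X^b * q -> a = b /\ p = q.
Proof.
wlog ab : a b p q / (a <= b)%N => [W p0 q0 E|p0 q0].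
  have [/W|/ltnW /W] := leqP a b; first exact.
  by case/(_ _ _ q0 p0) => // -> ->.
rewrite -(subnKC ab) exprD -mulrA => /(mulfI _) E.
have {}E : p = 'X^(b - a) * q by apply: E; rewrite expf_neq0 ?polyX_eq0.
case: (b - a)%N E => [|d] E; first by rewrite addn0 E expr0 mul1r.
by rewrite E hornerM hornerXn expr0n mul0r eqxx in p0.
Qed.

Section Signature.
Local Open Scope sesquilinear_scope.
Variables (n r : nat) (A : 'M[algC]_n) (q : {poly algC}).
Hypothesis Aherm : A \is hermsymmx.
Hypothesis q0 : q.[0] != 0.
(** Since [q] does not vanish at 0, this says that [A] has [r] nonzero eigenvalues and that they are
    the roots of [q]. *)
Hypothesis chiA : 'X^r * char_poly A = 'X^n * q.

Let U := spectralmx A.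
Let d := spectral_diag A.

Let Aeq : A = U^t* *m diag_mx d *m U.
Proof.
rewrite -invmx_unitary ?spectral_unitarymx //.
exact/orthomx_spectralP/hermitian_normalmx.
Qed.

Let chi_spec : char_poly A = \prod_i ('X - (d 0 i)%:P).
Proof.
have -> : char_poly A = char_poly (diag_mx d).
  rewrite Aeq -invmx_unitary ?spectral_unitarymx //.
  have := @char_poly_mulC _ _ _ (invmx U *m diag_mx d) U.
  rewrite mulmxA mulmxV ?spectral_unit // mul1mx.
  by move/mulfI; apply; rewrite expf_neq0 ?polyX_eq0.
rewrite char_poly_trig; last by apply/diag_mx_is_trig.
by apply: eq_bigr => i _; rewrite !mxE eqxx.
Qed.

Let Z := [set i | d 0 i != 0].

Let cardZ_q : #|Z| = r /\ q = \prod_(i in Z) ('X - (d 0 i)%:P).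
Proof.
have EA : char_poly A = 'X^(n - #|Z|) * \prod_(i in Z) ('X - (d 0 i)%:P).
  rewrite chi_spec (bigID (mem Z)) /= mulrC; congr (_ * _).
  rewrite (eq_bigr (fun=> 'X)) => [|i]; last first.
    by rewrite inE negbK => /eqP->; rewrite subr0.
  rewrite prodr_const; congr ('X^_).
  have := cardC Z; rewrite card_ord => En.
  by rewrite -[X in (X - _)%N]En addKn; apply: eq_card => i; rewrite !inE.
have nz : (\prod_(i in Z) ('X - (d 0 i)%:P)).[0] != 0.
  rewrite horner_prod; apply/prodf_neq0 => i.
  by rewrite inE !hornerE oppr_eq0.
have leZ : (#|Z| <= n)%N by rewrite -[X in (_ <= X)%N]card_ord max_card.
have := chiA; rewrite EA mulrA -exprD.
case/(mulXn_inj nz q0) => e ->; split => //.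
by apply/eqP; rewrite -(eqn_add2r (n - #|Z|)) e subnKC.
Qed.

Let g (i : 'I_r) : 'I_n := enum_val (cast_ord (esym cardZ_q.1) i).

Let sum_g (F : 'I_n -> algC) :
  (forall i, d 0 i = 0 -> F i = 0) -> \sum_i F i = \sum_k F (g k).
Proof.
move=> F0; rewrite (bigID (mem Z)) /= [X in _ + X]big1 ?addr0; last first.
  by move=> i; rewrite inE negbK => /eqP /F0.
rewrite big_enum_val; set e := cardZ_q.1.
rewrite (reindex (cast_ord (esym e))) //=.
by exists (cast_ord e) => i _; rewrite ?cast_ordKV ?cast_ordK.
Qed.

Let V := rowsub g U.

(** Eigenvectors for the eigenvalue 0 drop out of the spectral decomposition, so [A] factors through
    dimension [r]. The results on minors all rest on this. *)
Let A_V : A = V^t* *m diag_mx (\row_k d 0 (g k)) *m V.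
Proof.
apply/matrixP => i j; rewrite {1}Aeq !mul_mx_diag !mxE.
rewrite (sum_g (F := fun k => _)) => [|k dk]; last first.
  by rewrite !mxE dk mulr0 mul0r.
by apply: eq_bigr => k _; rewrite !mxE.
Qed.

(* Here and below, index functions need not be injective. *)
Lemma minor_gt_rank (k : nat) (f : 'I_k -> 'I_n) :
  (r < k)%N -> \det (mxsub f f A) = 0.
Proof.
move=> rk; apply/eqP; apply: contraTT rk; rewrite -unitfE => u.
have {}u : mxsub f f A \in unitmx by rewrite unitmxE.
rewrite -leqNgt -(mxrank_unit u) A_V mxsub_mul -[colsub f V]mul1mx.
apply: leq_trans (mxrankM_maxr _ _) _.
by rewrite mul1mx rank_leq_row.
Qed.

Let P := \prod_(i in Z) d 0 i.

Let gP : \prod_k d 0 (g k) = P.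
Proof.
rewrite /P [RHS]big_enum_val; set e := cardZ_q.1.
rewrite [RHS](reindex (cast_ord (esym e))) //=.
by exists (cast_ord e) => i _; rewrite ?cast_ordKV ?cast_ordK.
Qed.

(** The inner dimension is also [r], so determinants multiply: the minor is [P] times a squared
    modulus. *)
Let minor_factor (f : 'I_r -> 'I_n) :
  \det (mxsub f f A) = (\det (colsub f V))^* * P * \det (colsub f V).
Proof.
have -> : mxsub f f A
    = (colsub f V)^t* *m diag_mx (\row_k d 0 (g k)) *m colsub f V.
  by rewrite A_V; apply/matrixP => i j; rewrite !mul_mx_diag !mxE;
     apply: eq_bigr => k _; rewrite !mxE.
rewrite !det_mulmx det_diag det_map_mx det_tr -gP.
by congr (_ * _ * _); apply: eq_bigr => k _; rewrite mxE.
Qed.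

Lemma minor_rank_ge0 (f : 'I_r -> 'I_n) :
  0 <= (-1) ^+ r * q.[0] * \det (mxsub f f A).
Proof.
have -> : (-1) ^+ r * q.[0] = P.
  have [rE ->] := cardZ_q.
  rewrite horner_prod -rE -prodrN.
  by apply: eq_bigr => i _; rewrite !hornerE opprK.
have Preal : P \is Num.real.
  apply: rpred_prod => i _.
  by have /mxOverP := hermitian_spectral_diag_real Aherm; apply.
rewrite minor_factor mulrAC -normCKC mulrCA mulr_ge0 ?exprn_ge0 //.
by rewrite -expr2 -realEsqr.
Qed.

(** The rows of [V] are rows of an invertible matrix, so [V] has [r] independent columns; they
    select the minor. *)
Lemma minor_rank_neq0 : exists f : 'I_r -> 'I_n, \det (mxsub f f A) != 0.
Proof.
have g_inj : injective g by move=> i j /enum_val_inj /cast_ord_inj.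
have Vfull : row_full V^T.
  rewrite /row_full mxrank_tr; apply/row_freeP; exists (colsub g (invmx U)).
  rewrite -mxsub_mul mulmxV ?spectral_unit //.
  by apply/matrixP => i j; rewrite !mxE (inj_eq g_inj).
exists (fullrankfun Vfull); set f := fullrankfun Vfull.
have uV : \det (colsub f V) != 0.
  rewrite -unitfE -unitmxE -unitmx_tr.
  rewrite (_ : _^T = rowsub f V^T) ?fullrowsub_unit //.
  by apply/matrixP => i j; rewrite !mxE.
rewrite minor_factor !mulf_neq0 // ?conjC_eq0 //.
by apply/prodf_neq0 => i; rewrite inE.
Qed.

End Signature.

(** * Search over four-point distance configurations *)

Lemma nth_take_drop (T : Type) (x0 : T) s j k :
  nth x0 (take j s ++ drop j.+1 s) k = nth x0 s (bump j k).
Proof.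
rewrite nth_cat size_take_min /bump; have [kj|jk] := ltnP k j; last first.
  rewrite ltn_min ltnNge jk /= nth_drop add1n.
  have [js|sj] := leqP j (size s).
    by rewrite addSn subnKC.
  by rewrite !nth_default //; lia.
have [ks|sk] := ltnP k (size s); first by rewrite ltn_min kj ks nth_take.
by rewrite ltn_min kj ltnNge sk /= !nth_default // size_drop; lia.
Qed.

Section Laplace.
Variable R : comNzRingType.

Definition minor_seq (j : nat) (M : seq (seq R)) : seq (seq R) :=
  [seq take j r ++ drop j.+1 r | r <- behead M].

(** Laplace expansion along the first row. Over [Z] it is run by [vm_compute]; over [int] it unfolds
    to expressions for [ring]. *)
Fixpoint det_seq (n : nat) (M : seq (seq R)) : R :=
  if n is n'.+1 then
    foldr (fun j s => (if odd j then - 1 else 1) * nth 0 (head [::] M) j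
                        * det_seq n' (minor_seq j M) + s) 0 (iota 0 n)
  else 1.

Definition mx_of_seq (n : nat) (M : seq (seq R)) : 'M[R]_n :=
  \matrix_(i, j) nth 0 (nth [::] M i) j.

Lemma det_seqE (n : nat) (M : seq (seq R)) : \det (mx_of_seq n M) = det_seq n M.
Proof.
elim: n M => [|n IHn] M; first by rewrite det_mx00.
have foldrE (F : nat -> R) s :
    foldr (fun j x => F j + x) 0 s = \sum_(j <- s) F j.
  by elim: s => [|j s IHs]; rewrite ?big_nil ?big_cons //= IHs.
rewrite (expand_det_row _ ord0); apply/esym.
rewrite [LHS](foldrE (fun j => _) (index_iota 0 n.+1)) big_mkord.
apply: eq_bigr => j _; apply/esym.
rewrite mxE nth0 -mulrA mulrCA -/(det_seq n _).
rewrite /cofactor -IHn; congr (_ * _).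
have -> : (if odd j then -1 else 1 : R) = (-1) ^+ j.
    by rewrite -signr_odd; case: (odd j).
  by rewrite add0n.
congr (_ * _).
rewrite -[LHS]/(\det (row' ord0 (col' j (mx_of_seq n.+1 M)) : 'M_n)).
congr (\det _).
apply/matrixP => i k; rewrite !mxE.
case: M => [|r M] /=.
  by rewrite !(nth_nil [::]) !nth_nil.
have [iM|iM] := ltnP i (size M); last first.
  by rewrite [nth _ M i]nth_default // [nth [::] _ i]nth_default ?size_map // !nth_nil.
by rewrite [in RHS](nth_map [::]) // nth_take_drop.
Qed.

End Laplace.

Lemma det_seq_map (R S : comNzRingType) (phi : {rmorphism R -> S}) (n : nat)
    (M : seq (seq R)) :
  phi (det_seq n M) = det_seq n [seq [seq phi x | x <- r] | r <- M].
Proof.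
rewrite -!det_seqE -det_map_mx; congr determinant.
apply/matrixP => i j; rewrite !mxE.
have [iM|iM] := ltnP i (size M); last first.
  rewrite [nth _ M i]nth_default // [nth _ (map _ M) i]nth_default ?size_map //.
  by rewrite nth_nil [RHS]nth_nil; exact: rmorph0.
rewrite (nth_map [::]) //; have [jM|jM] := ltnP j (size (nth [::] M i)).
  by rewrite (nth_map 0).
rewrite nth_default // [RHS]nth_default ?size_map //; exact: rmorph0.
Qed.

Section ConfigurationSearch.

Implicit Types (M : seq (seq Z)) (v : seq Z).

Definition entry M (i j : nat) : Z := nth 0 (nth [::] M i) j.

(* [&&] and [||] evaluate both sides under [vm_compute]; nested conditionals
   stop at the first failure. *)
Fixpoint allc (T : Type) (p : T -> bool) (s : seq T) : bool :=
  if s is x :: s' then if p x then allc p s' else false else true.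

Lemma allcE (T : Type) (p : T -> bool) s : allc p s = all p s.
Proof. by elim: s => //= x s ->; case: (p x). Qed.

Fixpoint hasc (T : Type) (p : T -> bool) (s : seq T) : bool :=
  if s is x :: s' then if p x then true else hasc p s' else false.

Lemma hascE (T : Type) (p : T -> bool) s : hasc p s = has p s.
Proof. by elim: s => //= x s ->; case: (p x). Qed.

(** The choices of [k] positions among [n]. Trailing [false] entries are omitted, which does not
    change the result of [mask]. *)
Fixpoint masks (k n : nat) : seq (seq bool) :=
  match k, n with
  | 0, _ => [:: [::]]
  | _.+1, 0 => [::]
  | k'.+1, n'.+1 => map (cons true) (masks k' n') ++ map (cons false) (masks k n')
  end.

Definition submatrix (m : seq bool) M := mask m [seq mask m r | r <- M].

(** The conditions that [int_minors] yields for [r = 4] and [q.[0] > 0]. *)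
Definition minor_ok M : bool :=
  match size M with
  | 4 => Z.leb 0 (det_seq 4 M)
  | 5 => Z.eqb 0 (det_seq 5 M)
  | _ => true
  end.

(* In the next two tests the point with index 0 is the newly added one. *)
Definition triangle_ok M : bool :=
  let n := size M in
  allc (fun i => allc (fun j =>
    if Z.leb (entry M 0 i) (entry M 0 j + entry M i j)
    then Z.leb (entry M i j) (entry M 0 i + entry M 0 j) else false)
  (iota 0 n)) (iota 0 n).

Definition admissible M : bool :=
  if triangle_ok M then
    allc (fun m => minor_ok (submatrix m M))
      ([seq true :: m | m <- masks 3 (size M).-1]
       ++ [seq true :: m | m <- masks 4 (size M).-1])
  else false.

(** The border of a new point at index 0; the corner is the diagonal entry 1 of D + I. *)
Definition extend M v : seq (seq Z) :=
  (1%coqZ :: v) :: [seq p.1 :: p.2 | p <- zip v M].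

Fixpoint vectors (n : nat) : seq (seq Z) :=
  if n is n'.+1 then
    [seq x :: v | x <- [:: 1; 2; 3]%coqZ, v <- vectors n']
  else [:: [::]].

Definition unmet M (p : nat * nat) : bool :=
  if Z.ltb 1 (entry M p.1 p.2) then
    allc (fun k => if Z.eqb (entry M p.1 k) 1
                   then ~~ Z.eqb (entry M k p.2) (entry M p.1 p.2 - 1) else true)
         (iota 0 (size M))
  else false.

Definition pairs (n : nat) : seq (nat * nat) :=
  [seq (i, j) | i <- iota 0 n, j <- iota 0 n].

(* [dead fuel M] refutes the configuration [M]: it is inadmissible, or two of its
   points at distance at least 2 have no common intermediate point in it, and
   every way to add one leads to a dead configuration. *)
Fixpoint dead (fuel : nat) M : bool :=
  if admissible M then
    if fuel is fuel'.+1 then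
      if filter (unmet M) (pairs (size M)) is (i, j) :: _ then
        allc (fun v =>
          if Z.eqb (nth 0%coqZ v i) 1 then
            if Z.eqb (nth 0%coqZ v j) (entry M i j - 1) then dead fuel' (extend M v)
            else true
          else true) (vectors (size M))
      else false
    else false
  else true.

(** These are matrices D + I: [P4] and [C4] are numbered along the path and the cycle, and index 0
    is the centre of [K13]. *)
Definition P4 : seq (seq Z) :=
  [:: [:: 1; 1; 2; 3]; [:: 1; 1; 1; 2]; [:: 2; 1; 1; 1]; [:: 3; 2; 1; 1]]%coqZ.
Definition K13 : seq (seq Z) :=
  [:: [:: 1; 1; 1; 1]; [:: 1; 1; 2; 2]; [:: 1; 2; 1; 2]; [:: 1; 2; 2; 1]]%coqZ.
Definition C4 : seq (seq Z) :=
  [:: [:: 1; 1; 2; 1]; [:: 1; 1; 1; 2]; [:: 2; 1; 1; 1]; [:: 1; 2; 1; 1]]%coqZ.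

Definition reindexed M (c : seq nat) : seq (seq Z) :=
  [seq [seq entry M i j | j <- c] | i <- c].

Definition perms4 := Eval vm_compute in permutations (iota 0 4).

Definition is_base M : bool :=
  hasc (fun c => reindexed M c \in [:: P4; K13; C4]) perms4.

(** Three additional points suffice to refute every configuration that has a nonzero determinant and
    is not a base. *)
Definition base_check4 M : bool :=
  if Z.eqb (det_seq 4 M) 0 then true else
  if is_base M then true else dead 3 M.

(** On three points [dead 0] tests only the triangle inequality, which prunes before the fourth
    point is added. *)
Definition base_check3 M : bool :=
  if dead 0 M then true else
  allc (fun v => base_check4 (extend M v)) (vectors 3).

Definition base_check2 M : bool :=
  allc (fun v => base_check3 (extend M v)) (vectors 2).

Definition base_check : bool :=
  allc (fun v => base_check2 (extend [:: [:: 1%coqZ]] v)) (vectors 1).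

Lemma base_checkT : base_check. Proof. by vm_compute. Qed.

(** A row already in [M] belongs to a twin of a base point; any other row is refuted with at most
    one more point. *)
Definition ext_check : bool :=
  allc (fun M => allc (fun v => if v \in M then true else dead 1 (extend M v))
                      (vectors 4)) [:: P4; K13; C4].

Lemma ext_checkT : ext_check. Proof. by vm_compute. Qed.

Lemma mem_vectors v : all (mem [:: 1; 2; 3]%coqZ) v -> v \in vectors (size v).
Proof.
elim: v => [|x v IHv] // /andP[x3 /IHv vv].
exact: (allpairs_f cons x3 vv).
Qed.

End ConfigurationSearch.

(** * Soundness of the search for functions that behave like D + I *)

Section Soundness.
Variables (V : eqType) (a : V -> V -> Z).
Hypothesis a_diag : forall x, a x x = 1%coqZ.
Hypothesis a_sym : forall x y, a x y = a y x.
Hypothesis a_range : forall x y, a x y \in [:: 1; 2; 3]%coqZ.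
Hypothesis a_triangle : forall x y z, Z.leb (a x z) (a x y + a y z).
Hypothesis a_mid : forall x y, Z.ltb 1 (a x y) ->
  exists2 z, a x z = 1%coqZ & a z y = (a x y - 1)%coqZ.

Definition gram (xs : seq V) := [seq [seq a x y | y <- xs] | x <- xs].

Hypothesis minors4 : forall xs, size xs = 4%N -> Z.leb 0 (det_seq 4 (gram xs)).
Hypothesis minors5 : forall xs, size xs = 5%N -> det_seq 5 (gram xs) = 0%coqZ.

Lemma size_gram xs : size (gram xs) = size xs.
Proof. by rewrite size_map. Qed.

Lemma gram_cons z xs : gram (z :: xs) = extend (gram xs) (map (a z) xs).
Proof.
rewrite /gram /extend /= a_diag; congr (_ :: _).
elim: {2 3 5}xs => //= y ys IHy; rewrite a_sym; congr (_ :: _).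
exact: IHy.
Qed.

Lemma submatrix_gram m xs : submatrix m (gram xs) = gram (mask m xs).
Proof.
rewrite /submatrix /gram -map_comp -map_mask; apply: eq_map => x /=.
by rewrite map_mask.
Qed.

Lemma entry_gram x0 xs i j : (i < size xs)%N -> (j < size xs)%N ->
  entry (gram xs) i j = a (nth x0 xs i) (nth x0 xs j).
Proof. by move=> li lj; rewrite /entry (nth_map x0) // (nth_map x0). Qed.

Lemma admissible_gram xs : admissible (gram xs).
Proof.
rewrite /admissible; have -> : triangle_ok (gram xs).
  case: xs => [|x0 xs'] //; set xs := x0 :: xs'; set n := size xs.
  rewrite /triangle_ok allcE size_gram; apply/allP => i.
  rewrite mem_iota allcE => li; apply/allP => j; rewrite mem_iota => lj.
  rewrite !(entry_gram x0) //; set x := nth _ _ i; set y := nth _ _ j.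
  rewrite [a x y]a_sym a_triangle.
  by have := a_triangle y x0 x; rewrite [a y x0]a_sym Z.add_comm.
rewrite allcE; apply/allP => m _; rewrite submatrix_gram /minor_ok size_gram.
case E: size => [|[|[|[|[|[|]]]]]] //; first exact: minors4.
by rewrite minors5.
Qed.

(** Actual points satisfy all the tests, and the intermediate point that [dead] asks for exists by
    [a_mid]; its row is among the enumerated ones, so that branch survives by induction. *)
Lemma gram_alive fuel xs : dead fuel (gram xs) = false.
Proof.
elim: fuel xs => [|fuel IH] xs /=; rewrite admissible_gram //.
case E: filter => [|[i j] s] //.
have: (i, j) \in filter (unmet (gram xs)) (pairs (size (gram xs))).
  by rewrite E mem_head.
rewrite mem_filter => /andP[/=]; rewrite /unmet /= size_gram => unm.
case/allpairsP => -[i' j'] /= [+ + [??]]; subst i' j'.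
rewrite !mem_iota /= !add0n => li lj.
case: xs E unm li lj => // x0 xs' E; set xs := x0 :: xs' => unm li lj.
move: unm; case: ifP => // gt1 _.
rewrite !(entry_gram x0) // in gt1 *.
have [z xz zy] := a_mid gt1.
rewrite allcE; apply/negbTE/allPn; exists (map (a z) xs).
  rewrite -(size_map (a z) xs); apply: mem_vectors.
  by apply/allP => _ /mapP[w _ ->]; apply: a_range.
by rewrite !(nth_map x0) // a_sym xz Z.eqb_refl zy Z.eqb_refl -gram_cons IH.
Qed.

Lemma mem_gram_base xs z : gram xs \in [:: P4; K13; C4] ->
  map (a z) xs \in gram xs.
Proof.
move=> base; have := ext_checkT; rewrite /ext_check allcE => /allP/(_ _ base).
have s4 : size xs = 4%N.
  by rewrite -size_gram; move: base; rewrite !inE => /or3P[] /eqP->.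
rewrite allcE => /allP/(_ (map (a z) xs)).
rewrite -gram_cons gram_alive -s4 -(size_map (a z) xs).
case: (_ \in gram xs) => //; apply; apply: mem_vectors.
by apply/allP => _ /mapP[w _ ->]; apply: a_range.
Qed.

Lemma exists_base xs : size xs = 4%N -> det_seq 4 (gram xs) != 0 ->
  exists xs', size xs' = 4%N /\ gram xs' \in [:: P4; K13; C4].
Proof.
case: xs => [|x [|y [|z [|t [|]]]]] // _.
have vec u us : map (a u) us \in vectors (size us).
  rewrite -[in vectors _](size_map (a u)); apply: mem_vectors.
  by apply/allP => _ /mapP[w _ ->]; apply: a_range.
have E1 : [:: [:: 1%coqZ]] = gram [:: t] by rewrite /gram /= a_diag.
have : base_check2 (gram [:: z; t]).
  have := base_checkT; rewrite /base_check allcE E1 => /allP/(_ _ (vec z [:: t])).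
  by rewrite -gram_cons.
rewrite /base_check2 allcE => /allP/(_ _ (vec y [:: z; t])).
rewrite -gram_cons /base_check3 gram_alive allcE.
move=> /allP/(_ _ (vec x [:: y; z; t])); rewrite -gram_cons /base_check4 gram_alive.
case: Z.eqb_spec => [-> _ /eqP //|_]; case: ifP => // base _ _.
move: base; rewrite /is_base hascE => /hasP[c c4 cbase].
exists [seq nth x [:: x; y; z; t] i | i <- c].
have /andP[/eqP sc /allP cl] : (size c == 4%N) && all (fun i => i < 4)%N c.
  have /allP := isT : all (fun c => (size c == 4%N) && all (fun i => i < 4)%N c) perms4.
  exact.
split; first by rewrite size_map.
rewrite (_ : gram _ = reindexed (gram [:: x; y; z; t]) c) //.
rewrite /reindexed [LHS]/gram -map_comp.
apply/eq_in_map => i ic /=; rewrite -map_comp; apply/eq_in_map => j jc /=.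
by rewrite (entry_gram x) ?cl.
Qed.

(** Allows a row to be identified when column [k] is unknown, as happens when base point [k] is
    replaced by another point. *)
Lemma rows_separated M l m k : M \in [:: P4; K13; C4] ->
    (l < 4)%N -> (m < 4)%N -> (k < 4)%N ->
    (forall j, (j < 4)%N -> j != k -> entry M l j = entry M m j) -> l = m.
Proof.
pose I := iota 0 4.
have chk : all (fun M => all (fun l => all (fun m => all (fun k =>
    (l == m) || has (fun j => (j != k) && (entry M l j != entry M m j)) I)
    I) I) I) [:: P4; K13; C4] by vm_compute.
have inI i : (i < 4)%N -> i \in I by rewrite mem_iota.
move=> /(allP chk)/allP + /inI l4 /inI m4 /inI k4 eq_lm.
move=> /(_ l l4)/allP/(_ m m4)/allP/(_ k k4)/orP[/eqP //|/hasP[j]].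
by rewrite mem_iota => /eq_lm jP /andP[/jP ->]; rewrite eqxx.
Qed.

(* Replacing a base point by a point with the same row yields another base, so
   the distances between arbitrary points can be read off their rows. *)
Lemma class_map_of_base xs : size xs = 4%N -> gram xs \in [:: P4; K13; C4] ->
  exists c : V -> 'I_4, (forall k, exists x, c x = k) /\
    forall x y, a x y = entry (gram xs) (c x) (c y).
Proof.
move=> s4 base.
have x0 : V by case: (xs) s4 => [|x].
have lt4 z : (index (map (a z) xs) (gram xs) < 4)%N.
  by rewrite -[X in (_ < X)%N]s4 -size_gram index_mem mem_gram_base.
exists (fun z => Ordinal (lt4 z)); split => [k|z w] /=.
  have lk : (k < size xs)%N by rewrite s4.
  exists (nth x0 xs k); apply/val_inj => /=.
  have -> : map (a (nth x0 xs k)) xs = nth [::] (gram xs) k.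
    by rewrite (nth_map x0).
  apply: index_uniq; first by rewrite size_gram.
  by move: base; rewrite !inE => /or3P[] /eqP->.
have rowP u : exists2 k, (k < 4)%N & index (map (a u) xs) (gram xs) = k /\
    forall j, (j < 4)%N -> a u (nth x0 xs j) = a (nth x0 xs k) (nth x0 xs j).
  exists (index (map (a u) xs) (gram xs)) => //; split=> // j j4.
  have /(congr1 (fun r => nth 0 r j)) := nth_index [::] (mem_gram_base u base).
  by rewrite !(nth_map x0) ?s4.
have [k k4 [-> zk]] := rowP z; have [l l4 [-> wl]] := rowP w.
pose ys := set_nth x0 xs k z.
have sy : size ys = 4%N by rewrite size_set_nth s4; lia.
have nthy j : nth x0 ys j = if j == k then z else nth x0 xs j.
  by rewrite nth_set_nth.
have Ey : gram ys = gram xs.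
  apply: (@eq_from_nth _ [::]) => [|i]; rewrite !size_gram sy ?s4 // => i4.
  rewrite !(nth_map x0) ?s4 ?sy //.
  apply: (@eq_from_nth _ 0) => [|j]; rewrite !size_map sy ?s4 // => j4.
  rewrite !(nth_map x0) ?s4 ?sy // !nthy.
  case: (eqVneq i k) => [->|_]; case: (eqVneq j k) => [->|_] //.
  - by rewrite !a_diag.
  - exact: zk.
  - by rewrite a_sym zk // a_sym.
(* The row of [w] against the new base [ys] has some index [m]. Off column [k] it agrees with row
   [l], so [m = l], and column [k] then gives the distance from [w] to [z]. *)
have /(_ w) := @mem_gram_base ys; rewrite Ey => /(_ base).
case/(nthP [::]) => m; rewrite size_gram s4 => m4 wm.
have {}wm j : (j < 4)%N -> a (nth x0 xs m) (nth x0 xs j) = a w (nth x0 ys j).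
  move=> j4; move/(congr1 (fun r => nth 0 r j)): wm.
  by rewrite !(nth_map x0) ?s4 ?sy.
have elm : l = m.
  apply: (rows_separated base l4 m4 k4) => j j4 jk.
  rewrite !(entry_gram x0) ?s4 // wm // nthy (negbTE jk).
  by rewrite -wl.
by rewrite (entry_gram x0) ?s4 // a_sym [RHS]a_sym elm wm // nthy eqxx.
Qed.

End Soundness.

Local Close Scope ring_scope.

(** * Graph distance *)

Section Walks.
Variables (T : finType) (e : rel T).

Lemma walk_lenP x y k :
  reflect (exists p, [/\ size p = k, path e x p & last x p = y])
          (walk_len e x y k).
Proof.
apply: (iffP existsP) => [[p /andP[ep /eqP yp]]|[p [sp ep yp]]].
  by exists p; rewrite size_tuple.
by move/eqP: sp => sp; exists (Tuple sp); rewrite /= ep yp eqxx.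
Qed.

Lemma walk_len0 x y : walk_len e x y 0 = (x == y).
Proof.
apply/walk_lenP/eqP => [[p [/size0nil -> _ <-]] //|->].
by exists [::].
Qed.

Lemma walk_lenS x y k :
  reflect (exists2 z, e x z & walk_len e z y k) (walk_len e x y k.+1).
Proof.
apply: (iffP (walk_lenP _ _ _)) => [[[|z p] [] //= [sp] /andP[xz zp] yp]|].
  by exists z => //; apply/walk_lenP; exists p.
case=> z xz /walk_lenP[p [sp zp yp]]; exists (z :: p).
by rewrite /= sp xz zp yp.
Qed.

Lemma walk_lenD x y z k l :
  walk_len e x y k -> walk_len e y z l -> walk_len e x z (k + l).
Proof.
elim: k x => [|k IHk] x; first by rewrite walk_len0 => /eqP->.
case/walk_lenS => u xu uy yz; apply/walk_lenS; exists u => //.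
exact: IHk.
Qed.

Lemma gdist_min x y k : walk_len e x y k -> gdist e x y <= k.
Proof.
(* [gdist] searches below [#|T|] and never exceeds this bound, which settles longer walks. *)
move=> wk; have [kT|Tk] := ltnP k #|T|; last first.
  by apply: leq_trans Tk; rewrite -[X in _ <= X](size_iota 0) find_size.
rewrite leqNgt; apply/negP => lt; have := before_find 0 lt.
by rewrite nth_iota // wk.
Qed.

(** By [dS] no walk is shorter than [d], and [dpred] builds a walk of that length; [dT] keeps it
    within the range searched by [gdist]. *)
Lemma gdist_unique (d : T -> T -> nat) :
    (forall x y, (d x y == 0) = (x == y)) ->
    (forall x y z, e x z -> d x y <= (d z y).+1) ->
    (forall x y, 0 < d x y -> exists2 z, e x z & d x y = (d z y).+1) ->
    (forall x y, d x y < #|T|) ->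
  forall x y, gdist e x y = d x y.
Proof.
move=> d0 dS dpred dT x y.
have lower k u : walk_len e u y k -> d u y <= k.
  elim: k u => [|k IHk] u; first by rewrite walk_len0 -d0 => /eqP->.
  by case/walk_lenS => z uz /IHk zk; apply: leq_trans (dS _ _ _ uz) _.
have upper k u : d u y = k -> walk_len e u y k.
  elim: k u => [|k IHk] u du; first by rewrite walk_len0 -d0 du.
  have [|z uz] := dpred u y; first by rewrite du.
  by rewrite du => -[/esym/IHk wz]; apply/walk_lenS; exists z.
have w := upper _ x erefl.
apply/eqP; rewrite eqn_leq gdist_min //=.
apply: lower; rewrite /gdist; set s := iota 0 _.
have hs : has (walk_len e x y) s.
  by apply/hasP; exists (d x y) => //; rewrite mem_iota dT.
have := nth_find 0 hs; rewrite nth_iota //.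
by rewrite -[X in _ < X](size_iota 0) -has_find.
Qed.

Hypotheses (e_sym : symmetric e) (e_irr : irreflexive e).
Hypothesis e_conn : connected_graph e.

Lemma walk_gdist x y : walk_len e x y (gdist e x y).
Proof.
have hs : has (walk_len e x y) (iota 0 #|T|).
  have /connectP[p ep ->] := e_conn x y.
  (* A path without repeated vertices has length below [#|T|], so the search finds it. *)
  have [q eq uq _] := shortenP ep.
  apply/hasP; exists (size q); last by apply/walk_lenP; exists q.
  by have := max_card (mem (x :: q)); rewrite (card_uniqP uq) mem_iota.
have := nth_find 0 hs; rewrite nth_iota //.
by rewrite -[X in _ < X](size_iota 0) -has_find.
Qed.

Lemma gdist_eq0 x y : (gdist e x y == 0) = (x == y).
Proof.
rewrite -[RHS]walk_len0; apply/eqP/idP => [<-|/gdist_min]; first exact: walk_gdist.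
by rewrite leqn0 => /eqP.
Qed.

Lemma gdist_triangle x y z : gdist e x z <= gdist e x y + gdist e y z.
Proof. exact/gdist_min/walk_lenD/walk_gdist/walk_gdist. Qed.

Lemma gdist_le1 x y : e x y -> gdist e x y <= 1.
Proof.
by move=> xy; apply/gdist_min/walk_lenS; exists y => //; rewrite walk_len0.
Qed.

Lemma gdist_sym x y : gdist e x y = gdist e y x.
Proof.
suff le u v : gdist e u v <= gdist e v u by apply/eqP; rewrite eqn_leq !le.
apply/gdist_min; move: (walk_gdist v u); move: (gdist e v u) => k.
elim: k v => [|k IHk] v; first by rewrite !walk_len0 eq_sym.
case/walk_lenS => z vz /IHk uz; rewrite -addn1; apply: walk_lenD uz _.
by apply/walk_lenS; exists v; rewrite ?walk_len0 // e_sym.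
Qed.

Lemma gdist_pred x y : 0 < gdist e x y ->
  exists2 z, e x z & gdist e x y = (gdist e z y).+1.
Proof.
case E: gdist => [//|k] _; have := walk_gdist x y; rewrite E.
case/walk_lenS => z xz /gdist_min zy; exists z => //.
apply/eqP; rewrite eqSS eqn_leq zy andbT -ltnS -E.
apply: leq_trans (gdist_triangle x z y) _.
by rewrite -add1n leq_add2r gdist_le1.
Qed.

Lemma gdist_eq1 x y : (gdist e x y == 1) = e x y.
Proof.
apply/idP/idP => [/eqP E|xy].
  have [|z xz] := @gdist_pred x y; first by rewrite E.
  by rewrite E => -[/esym/eqP]; rewrite gdist_eq0 => /eqP<-.
rewrite eqn_leq gdist_le1 // lt0n gdist_eq0.
by apply: contraTneq xy => ->; rewrite e_irr.
Qed.

(** Following a geodesic down to distance exactly 4 from [y] leaves five vertices; triangle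
    inequalities force their remaining distances to be those of a path. *)
Lemma geodesic5 x y : 3 < gdist e x y ->
  exists z : 5.-tuple T, forall i j : 'I_5,
    gdist e (tnth z i) (tnth z j) = (i - j + (j - i))%N.
Proof.
have down k u : k <= gdist e u y -> exists u', gdist e u' y = k.
  move E : (gdist e u y) => n; elim: n u E => [|n IHn] u E kn.
    by exists u; rewrite E; move: kn; rewrite leqn0 => /eqP.
  move: kn; rewrite leq_eqVlt => /predU1P[->|kn]; first by exists u.
  have [|z _] := @gdist_pred u y; first by rewrite E.
  by rewrite E => -[/esym Ez]; apply: IHn Ez _.
case/down => x0 E0.
have step u k : gdist e u y = k.+1 -> exists2 v, gdist e u v = 1 & gdist e v y = k.
  move=> E; have [|v uv] := @gdist_pred u y; first by rewrite E.
  by rewrite E => -[->]; exists v => //; apply/eqP; rewrite gdist_eq1.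
have [x1 d01 E1] := step _ _ E0; have [x2 d12 E2] := step _ _ E1.
have [x3 d23 E3] := step _ _ E2; have [x4 d34 E4] := step _ _ E3.
have {step down} T3 := gdist_triangle.
have d0 u : gdist e u u = 0 by apply/eqP; rewrite gdist_eq0.
have {}E4 : x4 = y by apply/eqP; rewrite -gdist_eq0 E4.
subst y; exists [tuple x0; x1; x2; x3; x4] => i j.
have d02 : gdist e x0 x2 = 2.
  by have := T3 x0 x1 x2; have := T3 x0 x2 x4; lia.
have d03 : gdist e x0 x3 = 3.
  by have := T3 x0 x2 x3; have := T3 x0 x3 x4; lia.
have d13 : gdist e x1 x3 = 2.
  by have := T3 x1 x2 x3; have := T3 x1 x3 x4; lia.
rewrite !(tnth_nth x0); have dC := gdist_sym.
move: d0 dC d01 d02 d03 E0 d12 d13 E1 d23 E2 d34; move: (gdist e) => d.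
move=> d0 dC d01 d02 d03 d04 d12 d13 d14 d23 d24 d34.
case: i => -[|[|[|[|[|i]]]]] // iP; case: j => -[|[|[|[|[|j]]]]] // jP;
rewrite /= ?d0 //; rewrite ?(d01, d02, d03, d04, d12, d13, d14, d23, d24, d34) //;
by rewrite dC ?(d01, d02, d03, d04, d12, d13, d14, d23, d24, d34).
Qed.

End Walks.

Local Open Scope ring_scope.

(** * Characteristic polynomials of clique blow-ups *)

(** An integer symmetric matrix is Hermitian over [algC], where the spectral results apply; the
    conclusions descend along the injection of [int]. *)
Lemma int_minors (n r : nat) (A : 'M[int]_n) (q : {poly int}) :
    A^T = A -> q.[0] != 0 -> 'X^r * char_poly A = 'X^n * q ->
  [/\ forall k (f : 'I_k -> 'I_n), (r < k)%N -> \det (mxsub f f A) = 0,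
      forall f : 'I_r -> 'I_n, 0 <= (-1) ^+ r * q.[0] * \det (mxsub f f A) &
      exists f : 'I_r -> 'I_n, \det (mxsub f f A) != 0].
Proof.
move=> As q0 chi.
pose phi : {rmorphism int -> algC} := intr.
pose Ac := map_mx phi A; pose qc := map_poly phi q.
have herm : Ac \is hermsymmx.
  apply: realsym_hermsym.
    apply/is_hermitianmxP; rewrite expr0 scale1r.
    by apply/matrixP => i j; rewrite !mxE -{1}As mxE.
  by apply/mxOverP => i j; rewrite mxE realz.
have qc0 : qc.[0] = phi q.[0] by rewrite -horner_map rmorph0.
have qcn0 : qc.[0] != 0 by rewrite qc0 intr_eq0.
have chic : 'X^r * char_poly Ac = 'X^n * qc.
  by rewrite -map_char_poly -!(map_polyXn phi) -!rmorphM chi.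
have detE k (f : 'I_k -> 'I_n) :
    \det (mxsub f f Ac) = phi (\det (mxsub f f A)).
  by rewrite -det_map_mx map_mxsub.
split=> [k f rk|f|].
- have /eqP := minor_gt_rank herm qcn0 chic f rk.
  by rewrite detE intr_eq0 => /eqP.
- have := minor_rank_ge0 herm qcn0 chic f.
  by rewrite detE qc0 -(rmorph_sign phi) -!rmorphM ler0z.
have [f] := minor_rank_neq0 herm qcn0 chic.
by rewrite detE intr_eq0; exists f.
Qed.

Definition fibre_card (T : finType) (c : T -> nat) (k : nat) : nat :=
  #|[pred x | c x == k]|.

(** With [E] the incidence matrix of vertices and classes, the blow-up is [E *m B *m E^T], and
    [E^T *m E] is the diagonal matrix of class sizes; [char_poly_mulC] moves [E] to the other
    end. *)
Lemma char_poly_blowup (R : idomainType) (n k : nat) (B : 'M[R]_k)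
    (c : 'I_n -> 'I_k) :
  'X^k * char_poly (\matrix_(i, j) B (c i) (c j))
    = 'X^n * char_poly (B *m diag_mx (\row_l (fibre_card c l)%:R)).
Proof.
pose E : 'M[R]_(n, k) := \matrix_(i, l) (c i == l)%:R.
have -> : \matrix_(i, j) B (c i) (c j) = E *m (B *m E^T).
  apply/matrixP => i j; rewrite !mxE (bigD1 (c i)) //= !mxE eqxx mul1r.
  rewrite [X in _ + X]big1 ?addr0 => [|l li]; last first.
    by rewrite !mxE eq_sym (negbTE li) mul0r.
  rewrite (bigD1 (c j)) //= !mxE eqxx mulr1 big1 ?addr0 // => l lj.
  by rewrite !mxE eq_sym (negbTE lj) mulr0.
rewrite char_poly_mulC -mulmxA; congr (_ * char_poly (_ *m _)).
apply/matrixP => l m; rewrite !mxE.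
under eq_bigr do rewrite !mxE -natrM mulnb.
rewrite -natr_sum; have [<-|lm] := eqVneq l m; last first.
  rewrite mulr0n big1 // => i _; case: eqP => //= ->.
  by rewrite (negbTE lm).
under eq_bigr do rewrite andbb -val_eqE.
rewrite mulr1n /fibre_card -sum1_card; congr (_%:R); rewrite [RHS]big_mkcond.
by apply: eq_bigr => i _; rewrite inE; case: eqP.
Qed.

Definition int_mx (M : seq (seq Z)) : 'M[int]_4 :=
  mx_of_seq 4 [seq [seq int_of_Z x | x <- r] | r <- M].

Lemma horner_char_poly4 (M : seq (seq int)) (w : nat -> int) (x : int) :
  (char_poly (mx_of_seq 4 M *m diag_mx (\row_l w l))).[x] =
  det_seq 4 [seq [seq (if i == j then x else 0) - nth 0 (nth [::] M i) j * w j
               | j <- iota 0 4] | i <- iota 0 4].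
Proof.
rewrite -horner_evalE -det_map_mx -det_seqE; congr (\det _).
apply/matrixP => i j; rewrite mul_mx_diag !mxE -[LHS]/(_.[x]).
rewrite hornerD hornerN hornerMn hornerX hornerC.
by rewrite (nth_map 0%N) ?size_iota // nth_iota // (nth_map 0%N) ?size_iota //
   nth_iota // add0n; rewrite -val_eqE; case: (_ == _).
Qed.

Lemma horner_char_P4 (w : nat -> int) (x : int) :
  let a := w 0%N in let b := w 1%N in let c := w 2%N in let d := w 3%N in
  (char_poly (int_mx P4 *m diag_mx (\row_l w l))).[x] =
  x ^+ 4 - (a + b + c + d) * x ^+ 3 - (3 * a * c + 3 * b * d + 8 * a * d) * x ^+ 2
    + (a * b * c + b * c * d + a * b * d + a * c * d) * x + a * b * c * d.
Proof.
move=> a b c d; rewrite horner_char_poly4 /=.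
rewrite -[Posz (Pos.to_nat 1)]/(1 : int) -[Posz (Pos.to_nat 2)]/(2 : int).
by rewrite -[Posz (Pos.to_nat 3)]/(3 : int) -/a -/b -/c -/d; ring.
Qed.

Lemma horner_char_K13 (w : nat -> int) (x : int) :
  let a := w 0%N in let b := w 1%N in let c := w 2%N in let d := w 3%N in
  (char_poly (int_mx K13 *m diag_mx (\row_l w l))).[x] =
  x ^+ 4 - (a + b + c + d) * x ^+ 3 - 3 * (b * c + c * d + b * d) * x ^+ 2
    + (a * (b * c + c * d + b * d) - 5 * b * c * d) * x + 2 * a * b * c * d.
Proof.
move=> a b c d; rewrite horner_char_poly4 /=.
rewrite -[Posz (Pos.to_nat 1)]/(1 : int) -[Posz (Pos.to_nat 2)]/(2 : int).
by rewrite -/a -/b -/c -/d; ring.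
Qed.

Lemma horner_char_C4 (w : nat -> int) (x : int) :
  let a := w 0%N in let b := w 1%N in let c := w 2%N in let d := w 3%N in
  (char_poly (int_mx C4 *m diag_mx (\row_l w l))).[x] =
  x ^+ 4 - (a + b + c + d) * x ^+ 3 - 3 * (a * c + b * d) * x ^+ 2
    + (a * b * c + b * c * d + a * b * d + a * c * d) * x + 5 * a * b * c * d.
Proof.
move=> a b c d; rewrite horner_char_poly4 /=.
rewrite -[Posz (Pos.to_nat 1)]/(1 : int) -[Posz (Pos.to_nat 2)]/(2 : int).
by rewrite -/a -/b -/c -/d; ring.
Qed.

(** The difference of the two sides has degree at most 3, so its values at 0, 1, -1 and 2 determine
    it. *)
Lemma quartic_coef (p1 p2 p3 p4 q1 q2 q3 q4 : int) :
    (forall x, x ^+ 4 - p1 * x ^+ 3 - p2 * x ^+ 2 + p3 * x + p4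
             = x ^+ 4 - q1 * x ^+ 3 - q2 * x ^+ 2 + q3 * x + q4) ->
  [/\ p1 = q1, p2 = q2, p3 = q3 & p4 = q4].
Proof.
move=> E; have := E 0; have := E 1; have := E (-1); have := E 2.
by move=> *; split; lia.
Qed.

(** Each of [b * c], [c * d], [b * d] is at most [a * b * c * d], half of [s * t]; the left side of
    the second-degree equation is then at most 9/2 of [s * t], below 8 times it. *)
Lemma K13_spectrum_absurd (a b c d s t : int) :
    0 < a -> 0 < b -> 0 < c -> 0 < d -> 0 < s -> 0 < t ->
    3 * (b * c + c * d + b * d) = 3 * (s + t) + 8 * s * t ->
    2 * a * b * c * d = s * t -> False.
Proof.
move=> a0 b0 c0 d0 s0 t0 E2 E4.
have : b * c <= b * c * d by nia.
have : c * d <= b * c * d by nia.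
have : b * d <= b * c * d by nia.
have : b * c * d <= a * b * c * d by nia.
lia.
Qed.

(** As for [K13]: both products are at most a fifth of [s * t]. *)
Lemma C4_spectrum_absurd (a b c d s t : int) :
    0 < a -> 0 < b -> 0 < c -> 0 < d -> 0 < s -> 0 < t ->
    3 * (a * c + b * d) = 3 * (s + t) + 8 * s * t ->
    5 * a * b * c * d = s * t -> False.
Proof.
move=> a0 b0 c0 d0 s0 t0 E2 E4.
have : a * c <= a * b * c * d by nia.
have : b * d <= a * b * c * d by nia.
lia.
Qed.

(* With p = b c and q = a d, substituting the first and fourth equations into the
   third gives (a-1)(d-1)(p-1) + (b-1)(c-1)(q-1) = 0, a sum of nonnegative terms;
   if p > 1, then a = 1 or d = 1, which contradicts the second equation. *)
Lemma P4_spectrum_weights (a b c d s t : int) :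
    0 < a -> 0 < b -> 0 < c -> 0 < d -> 0 < s -> 0 < t ->
    a + b + c + d = s + t + 2 ->
    3 * a * c + 3 * b * d + 8 * a * d = 3 * (s + t) + 8 * s * t ->
    a * b * c + b * c * d + a * b * d + a * c * d
      = s + t + 2 * s * t ->
    a * b * c * d = s * t ->
  [/\ b = 1, c = 1 & (a = s /\ d = t) \/ (a = t /\ d = s)].
Proof.
move=> a0 b0 c0 d0 s0 t0 E1 E2 E3 E4.
have tE : t = a + b + c + d - 2 - s by lia.
have {}E4 : s * t = a * b * c * d by lia.
have {}E3 : (a - 1) * (d - 1) * (b * c - 1) + (b - 1) * (c - 1) * (a * d - 1) = 0.
  have : a * b * c + b * c * d + a * b * d + a * c * d
     = a + b + c + d - 2 + 2 * (a * b * c * d) by lia.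
  lia.
have {}E2 : 3 * (a * c + b * d) + 8 * (a * d)
    = 3 * (a + b + c + d - 2) + 8 * (a * b * c * d) by lia.
set u := b * c - 1 in E3.
have ub : b - 1 <= u by have : 0 <= b * (c - 1) by [rewrite mulr_ge0; lia]; rewrite /u; lia.
have uc : c - 1 <= u by have : 0 <= c * (b - 1) by [rewrite mulr_ge0; lia]; rewrite /u; lia.
have u0 : 0 <= u by lia.
have ad1 : 0 <= a * d - 1 by rewrite subr_ge0 -[1]mulr1 ler_pM.
have F1 : 0 <= (a - 1) * (d - 1) by rewrite mulr_ge0; lia.
have F2 : 0 <= (b - 1) * (c - 1) by rewrite mulr_ge0; lia.
have {E3} /eqP : (a - 1) * (d - 1) * u = 0.
  by have := mulr_ge0 F1 u0; have := mulr_ge0 F2 ad1; lia.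
(* For [a = 1] or [d = 1] the second equation becomes [3 * ((w - 1) * (v - 1)) = 8 * (v * u)]. Its
   left side is at most [3 * u * (v - 1)], which forces [u = 0]. *)
have key v w : 0 < v -> w - 1 <= u -> 3 * ((w - 1) * (v - 1)) = 8 * (v * u) -> u = 0.
  move=> v0 wu e.
  have : (w - 1) * (v - 1) <= u * (v - 1) by rewrite ler_wpM2r //; lia.
  by have := mulr_ge0 (ltW v0) u0; lia.
rewrite !mulf_eq0 => G.
have {G} uE : u = 0.
  case/orP: G => [/orP[]|] /eqP //.
    move=> aE; apply: (key d b) => //.
    by have a1 : a = 1 by [lia]; rewrite /u; rewrite a1 in E2; lia.
  move=> dE; apply: (key a c) => //.
  by have d1 : d = 1 by [lia]; rewrite /u; rewrite d1 in E2; lia.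
have b1 : b = 1 by lia.
have c1 : c = 1 by lia.
(* Now [a + d = s + t] and [a * d = s * t], so [a] is a root of the quadratic with roots [s] and
   [t]. *)
split=> //; have /eqP : (a - s) * (a - t) = 0.
  rewrite b1 c1 in tE E4; have -> : t = a + d - s by lia.
  by rewrite (_ : t = a + d - s) in E4; lia.
by rewrite mulf_eq0 => /orP[] /eqP; [left|right]; lia.
Qed.

(** * Cospectral graphs as blow-ups *)

(* The entries of D(G) + I. *)
Definition adist (T : finType) (e : rel T) (x y : T) : nat :=
  (gdist e x y + (x == y))%N.

Definition adist_mx (n : nat) (e : rel 'I_n) : 'M[int]_n :=
  \matrix_(i, j) Posz (adist e i j).

Lemma dist_matrix_add1 (n : nat) (e : rel 'I_n) :
  dist_matrix e + 1%:M = adist_mx e.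
Proof. by apply/matrixP => i j; rewrite !mxE PoszD; case: (i == j). Qed.

Lemma D_cospectral_adist (m n : nat) (e1 : rel 'I_m) (e2 : rel 'I_n) :
  D_cospectral e1 e2 -> char_poly (adist_mx e1) = char_poly (adist_mx e2).
Proof.
by move=> E; rewrite -!dist_matrix_add1 !char_poly_addr1; congr (_ \Po _).
Qed.

Section Geometry.
Variables (n : nat) (e : rel 'I_n).
Hypotheses (e_simple : simple_graph e) (e_conn : connected_graph e).

Let e_sym := e_simple.1.
Let e_irr := e_simple.2.

Lemma adist_diag x : adist e x x = 1%N.
Proof. by rewrite /adist eqxx; have /eqP-> : gdist e x x == 0%N by rewrite gdist_eq0. Qed.

Lemma adist_neq x y : x != y -> adist e x y = gdist e x y.
Proof. by rewrite /adist => /negbTE->; rewrite addn0. Qed.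

Lemma adist_sym x y : adist e x y = adist e y x.
Proof. by rewrite /adist gdist_sym // eq_sym. Qed.

Lemma adist_gt0 x y : (0 < adist e x y)%N.
Proof. by rewrite /adist -(gdist_eq0 e_conn); case: gdist. Qed.

Lemma adist_triangle x y z : (adist e x z <= adist e x y + adist e y z)%N.
Proof.
have [<-|xz] := eqVneq x z; last first.
  rewrite (adist_neq xz); apply: leq_trans (gdist_triangle e_conn x y z) _.
  by rewrite /adist; lia.
by rewrite adist_diag; apply: leq_trans (adist_gt0 x y) (leq_addr _ _).
Qed.

Lemma adist_mid x y : (1 < adist e x y)%N ->
  exists2 z, adist e x z = 1%N & (adist e z y).+1 = adist e x y.
Proof.
have [->|xy] := eqVneq x y; first by rewrite adist_diag.
rewrite (adist_neq xy) => d1.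
have [|z xz dz] := gdist_pred e_conn (x := x) (y := y); first exact: ltnW.
have dxz : gdist e x z = 1%N by apply/eqP; rewrite gdist_eq1.
exists z; first by rewrite adist_neq // -(gdist_eq0 e_conn) dxz.
rewrite adist_neq ?dz // -(gdist_eq0 e_conn); apply: contraTneq d1 => zy.
by rewrite dz zy.
Qed.

Lemma adist_eq1 x y : e x y = (x != y) && (adist e x y == 1%N).
Proof.
rewrite -(gdist_eq1 e_irr e_conn); have [->|xy] := eqVneq x y.
  by have /eqP-> : gdist e y y == 0%N by rewrite gdist_eq0.
by rewrite adist_neq.
Qed.

Hypothesis minors5 : forall f : 'I_5 -> 'I_n, \det (mxsub f f (adist_mx e)) = 0.
Hypothesis minors4 : forall f : 'I_4 -> 'I_n,
  0 <= \det (mxsub f f (adist_mx e)).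

(** A larger distance would give an isometric path on five vertices, whose matrix D + I has nonzero
    determinant. *)
Lemma adist_le3 x y : (adist e x y <= 3)%N.
Proof.
have [->|xy] := eqVneq x y; first by rewrite adist_diag.
rewrite adist_neq // leqNgt; apply/negP => /(geodesic5 e_sym e_irr e_conn)[z dz].
have /eqP := minors5 (tnth z); apply/negP.
pose P5 := [seq [seq Posz (maxn 1 (i - j + (j - i))) | j <- iota 0 5] | i <- iota 0 5].
rewrite (_ : mxsub _ _ _ = mx_of_seq 5 P5) ?det_seqE //.
apply/matrixP => i j; rewrite !mxE (nth_map 0%N) ?size_iota //.
rewrite (nth_map 0%N) ?size_iota // !nth_iota // !add0n; congr Posz.
rewrite /adist -(gdist_eq0 e_conn) dz.
by move: (i - j + (j - i))%N => -[|k] /=; lia.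
Qed.

Let a x y := Z.of_nat (adist e x y).

Lemma gram_det k (xs : k.-tuple 'I_n) :
  int_of_Z (det_seq k (gram a xs)) = \det (mxsub (tnth xs) (tnth xs) (adist_mx e)).
Proof.
rewrite det_seq_map -det_seqE; congr (\det _); apply/matrixP => i j.
have x0 := tnth xs i.
rewrite !mxE /gram -map_comp (nth_map x0) ?size_tuple // /= -map_comp.
rewrite (nth_map x0) ?size_tuple //= -!tnth_nth /a.
by case: (adist e _ _) => [|k'] //=; lia.
Qed.

(** The metric properties of D + I and the minor conditions are exactly what the soundness results
    ask for: the nonzero minor yields a base, and the rows against it sort the vertices into
    classes. *)
Lemma blowup_of_minors :
    (exists f : 'I_4 -> 'I_n, \det (mxsub f f (adist_mx e)) != 0) ->
  exists2 M, M \in [:: P4; K13; C4] & exists c : 'I_n -> 'I_4,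
    (forall k, exists x, c x = k) /\
    forall x y, Posz (adist e x y) = int_mx M (c x) (c y).
Proof.
case=> f f0.
have a_diag x : a x x = 1%coqZ by rewrite /a adist_diag.
have a_sym x y : a x y = a y x by rewrite /a adist_sym.
have a_range x y : a x y \in [:: 1; 2; 3]%coqZ.
  rewrite /a; have := adist_le3 x y; have := adist_gt0 x y.
  by case: (adist e x y) => [|[|[|[|]]]].
have a_tri x y z : Z.leb (a x z) (a x y + a y z).
  by rewrite /a; have := adist_triangle x y z; lia.
have a_mid x y : Z.ltb 1 (a x y) ->
    exists2 z, a x z = 1%coqZ & a z y = (a x y - 1)%coqZ.
  move=> xy; have [|z xz zy] := @adist_mid x y; first by rewrite /a in xy; lia.
  by exists z; rewrite /a ?xz //; lia.
have m4 xs : size xs = 4%N -> Z.leb 0 (det_seq 4 (gram a xs)).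
  move/eqP => s4; have := minors4 (tnth (Tuple s4)); rewrite -gram_det /=; lia.
have m5 xs : size xs = 5%N -> det_seq 5 (gram a xs) = 0%coqZ.
  move/eqP => s5; have := minors5 (tnth (Tuple s5)); rewrite -gram_det /=; lia.
have [|xs [s4 base]] := exists_base a_diag a_sym a_range a_tri a_mid m4 m5
    (xs := [tuple f i | i < 4]) (size_tuple _).
  apply: contraNneq f0 => d0; pose fs := [tuple f i | i < 4].
  rewrite (_ : mxsub f f _ = mxsub (tnth fs) (tnth fs) (adist_mx e)).
    by rewrite -gram_det d0 rmorph0.
  by apply/matrixP => i j; rewrite !mxE !tnth_mktuple.
have [c [csurj cE]] := class_map_of_base a_diag a_sym a_range a_tri a_mid m4 m5 s4 base.
exists (gram a xs) => //; exists c; split=> // x y.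
have sM : size (gram a xs) = 4%N by rewrite size_gram.
rewrite /int_mx !mxE (nth_map [::]) ?sM // (nth_map 0); last first.
  by rewrite (nth_map x) ?s4 // size_map s4.
by have := cE x y; rewrite /entry /a => <-; lia.
Qed.

End Geometry.

(** * Distances in the graph K *)

Section Kst_distance.
Local Open Scope nat_scope.
Variables (s t : nat).
Hypotheses (hs : (2 <= s)) (ht : (2 <= t)).

(** The position on P4: the bridge ends [0] and [s] have positions 1 and 2, and the rest of each
    clique lies at the outer positions 0 and 3. *)
Definition Kclass (x : nat) : nat :=
  if x == 0 then 1 else if (x < s) then 0 else if x == s then 2 else 3.

Lemma Kclass_lt4 x : (Kclass x < 4).
Proof. by rewrite /Kclass; case: (x == 0) => //; case: (x < s) => //; case: (x == s). Qed.

(** The distance along P4, raised to 1 for distinct vertices of one class. *)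
Definition Kdist (x y : 'I_(s + t)) : nat :=
  if x == y then 0 else
    maxn 1 (Kclass x - Kclass y + (Kclass y - Kclass x)).

Lemma Kst_class x y : @Kst s t x y =
  (x != y) && (Kclass x - Kclass y + (Kclass y - Kclass x) <= 1).
Proof.
rewrite /Kst /Kclass; congr (_ && _).
case: x => x xP; case: y => y yP /=.
by do ?case: ifP; lia.
Qed.

Lemma gdist_Kst x y : gdist (@Kst s t) x y = Kdist x y.
Proof.
have lt0 : (0 < s + t) by lia.
have lts : (s < s + t) by lia.
pose o0 := Ordinal lt0; pose os := Ordinal lts.
have k0 : Kclass o0 = 1 by [].
have ks : Kclass os = 2 by rewrite /Kclass /= ltnn eqxx; case: eqP => //; lia.
apply: gdist_unique => {x y} [x y|x y z|x y|x y].
- by rewrite /Kdist; case: (x == y) => //; lia.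
- rewrite Kst_class /Kdist => /andP[_ xz]; case: (eqVneq x y) => // _.
  by move: xz; case: (eqVneq z y) => [->|_]; lia.
- rewrite /Kdist; have [//|xy _] := eqVneq x y.
  set kx := Kclass x; set ky := Kclass y.
  have kx4 : (kx < 4) := Kclass_lt4 x; have ky4 : (ky < 4) := Kclass_lt4 y.
  have [d1|d1] := leqP (kx - ky + (ky - kx)) 1.
    exists y; first by rewrite Kst_class xy.
    by rewrite eqxx; lia.
  have neq (u v : 'I_(s + t)) : Kclass u <> Kclass v -> (u == v) = false.
    by move=> uv; apply/eqP => E; rewrite E in uv.
  have out (u : 'I_(s + t)) : Kclass x <> Kclass u -> Kclass u <> Kclass y ->
      (kx - Kclass u + (Kclass u - kx) <= 1) ->
      kx - ky + (ky - kx) = (maxn 1 (Kclass u - ky + (ky - Kclass u))).+1 ->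
    exists2 z, Kst x z & kx - ky + (ky - kx) =
      (if z == y then 0 else maxn 1 (Kclass z - ky + (ky - Kclass z))).+1.
    move=> xu uy ? ?; exists u; first by rewrite Kst_class neq.
    by rewrite neq.
  (* Towards a class at distance at least 2, the next class after 0 or 2 is 1, and after 1 or 3 it
     is 2; the bridge ends serve as intermediate vertices. *)
  have [kx_even|kx_odd] : (kx = 0 \/ kx = 2) \/ (kx = 1 \/ kx = 3) by lia.
    by apply: (out o0); rewrite -/kx -/ky k0; lia.
  by apply: (out os); rewrite -/kx -/ky ks; lia.
- rewrite /Kdist card_ord; have := Kclass_lt4 x; have := Kclass_lt4 y.
  by case: eqP => //; lia.
Qed.

End Kst_distance.

Local Close Scope ring_scope.

(** * From class sizes to an isomorphism *)

Lemma fibre_card_Kclass (s t k : nat) : 0 < s -> 0 < t ->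
  fibre_card (fun x : 'I_(s + t) => Kclass s x) k =
  (s - 1) * (k == 0) + (k == 1) + (k == 2) + (t - 1) * (k == 3).
Proof.
case: s => // s _; case: t => // t _; rewrite !subn1 /=.
rewrite /fibre_card -sum1_card big_mkcond big_split_ord /=.
rewrite !big_ord_recl /=.
under eq_bigr => i _.
  have -> : (lshift t.+1 (lift ord0 i) \in [pred x : 'I_(s.+1 + t.+1) | Kclass s.+1 x == k]) = (k == 0).
    by rewrite inE /= /Kclass /= /bump /= ltnS ltn_ord eq_sym.
  over.
under [X in _ + (_ + X)]eq_bigr => i _.
  have -> : (rshift s.+1 (lift ord0 i) \in [pred x : 'I_(s.+1 + t.+1) | Kclass s.+1 x == k]) = (k == 3).
    by rewrite inE /= /Kclass /= /bump /=; do ?case: ifP; lia.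
  over.
rewrite !sum_nat_const !card_ord !inE /= /Kclass /= addn0 ltnn eqxx.
by rewrite ![_ == k]eq_sym; do 4!case: (k == _); lia.
Qed.

(** Equal fibre sizes make the two lists of values permutations of each other, and the permutation
    is the bijection. *)
Lemma bijection_of_fibres (n : nat) (c c' : 'I_n -> nat) :
  (forall k, fibre_card c k = fibre_card c' k) ->
  exists f : 'I_n -> 'I_n, bijective f /\ forall x, c' (f x) = c x.
Proof.
move=> cc.
have /tuple_permP[p Ep] : perm_eq [tuple c i | i < n] [tuple c' i | i < n].
  have cnt g k : count_mem k [tuple g i | i < n] = fibre_card g k.
    rewrite /= count_map enumT /fibre_card cardE [in RHS]/enum_mem size_filter.
    exact: eq_count.
  by apply/allP => k _; apply/eqP; rewrite !cnt.
exists p; split; first by exists (p^-1)%g; [exact: permK | exact: permKV].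
move=> x; have := congr1 (fun s => nth 0 s x) Ep.
by rewrite -!tnth_nth !tnth_mktuple.
Qed.

Lemma int_mx_P4 (i j : 'I_4) :
  int_mx P4 i j = Posz (maxn 1 (i - j + (j - i))).
Proof.
rewrite !mxE; case: i => -[|[|[|[|i]]]] // iP; case: j => -[|[|[|[|j]]]] // jP.
Qed.

Lemma Kst_iso (s t : nat) (e : rel 'I_(s + t)) (c : 'I_(s + t) -> nat) :
    1 < s -> 1 < t ->
    (forall x y, e x y = (x != y) && (c x - c y + (c y - c x) <= 1)) ->
    (forall k, fibre_card c k
             = fibre_card (fun x : 'I_(s + t) => Kclass s x) k) ->
  graph_iso e (@Kst s t).
Proof.
move=> hs ht ec /bijection_of_fibres[f [bf fc]].
exists f; split=> // x y.
by rewrite Kst_class // ec !fc (inj_eq (bij_inj bf)).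
Qed.

Lemma P4_blowup_iso (s t : nat) (e : rel 'I_(s + t)) (c : 'I_(s + t) -> 'I_4) :
    1 < s -> 1 < t ->
    (forall x y, e x y = (x != y) && (c x - c y + (c y - c x) <= 1)) ->
    fibre_card c 1 = 1 -> fibre_card c 2 = 1 ->
    fibre_card c 0 = s - 1 /\ fibre_card c 3 = t - 1 \/
    fibre_card c 0 = t - 1 /\ fibre_card c 3 = s - 1 ->
  graph_iso e (@Kst s t).
Proof.
move=> s1 t1 ec c1 c2 c03.
have KE k := fibre_card_Kclass k (ltnW s1) (ltnW t1).
have fibre0 (g : 'I_(s + t) -> nat) k :
    (forall x, g x < 4) -> 4 <= k -> fibre_card g k = 0.
  move=> g4 k4; apply: eq_card0 => x; rewrite inE.
  by apply: contraTF k4 => /eqP<-; rewrite -ltnNge.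
have rev_diff (i j : 'I_4) :
    3 - i - (3 - j) + (3 - j - (3 - i)) = i - j + (j - i).
  by case: i j => i i4 [j j4] /=; clear - i4 j4; lia.
case: c03 => -[c0 c3].
  apply: (Kst_iso (c := c)) => // k.
  have [|k4] := ltnP k 4; last by rewrite !fibre0 // => x; apply: Kclass_lt4.
  rewrite KE; case: k => [|[|[|[|]]]] // _.
  - by rewrite c0 muln1 muln0 !addn0.
  - by rewrite c1 !muln0.
  - by rewrite c2 !muln0.
  by rewrite c3 muln1 muln0.
(* The sizes appear in reverse order, so P4 is read from its other end. *)
apply: (Kst_iso (c := fun x => 3 - c x)) => // [x y|k].
  by rewrite ec rev_diff.
have [k4|k4] := ltnP k 4; last first.
  by rewrite !fibre0 // => x; [apply: Kclass_lt4 | rewrite ltnS leq_subr].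
have -> : fibre_card (fun x => 3 - c x) k = fibre_card c (3 - k).
  apply: eq_card => x; rewrite !inE; have := ltn_ord (c x).
  by move: k4 {c0 c1 c2 c3}; move: (nat_of_ord (c x)) => i; clear; lia.
rewrite KE; case: k k4 => [|[|[|[|]]]] // _.
- by rewrite c3 muln1 muln0 !addn0.
- by rewrite c2 !muln0.
- by rewrite c1 !muln0.
by rewrite c0 muln1 muln0.
Qed.

Theorem theorem3p4 (s t : nat) (hs : 2 <= s) (ht : 2 <= t)
  (m : nat) (e : rel 'I_m) :
  simple_graph e -> connected_graph e ->
  D_cospectral e (@Kst s t) ->
  graph_iso e (@Kst s t).
Proof.
move=> simp conn cosp.
have em : m = s + t.
  have := congr1 (fun p : {poly int} => size p) cosp.
  by rewrite /D_spectrum !size_char_poly => -[].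
subst m; have := D_cospectral_adist cosp.
pose kc (x : 'I_(s + t)) : 'I_4 := Ordinal (Kclass_lt4 s x).
have -> : adist_mx (@Kst s t) = (\matrix_(x, y) int_mx P4 (kc x) (kc y))%R.
  apply/matrixP => x y; rewrite [LHS]mxE [RHS]mxE int_mx_P4 /adist gdist_Kst //.
  rewrite /Kdist; congr Posz => /=; case: (eqVneq x y) => [->|]; lia.
move=> chiA.
set q : {poly int} := char_poly (int_mx P4 *m diag_mx (\row_l (fibre_card kc l)%:R))%R.
have chiq : ('X^4 * char_poly (adist_mx e) = 'X^(s + t) * q)%R.
  by rewrite chiA char_poly_blowup.
have wK k : fibre_card kc k =
    (s - 1) * (k == 0) + (k == 1) + (k == 2) + (t - 1) * (k == 3).
  have -> : fibre_card kc k = fibre_card (fun x : 'I_(s + t) => Kclass s x) k by [].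
  by rewrite fibre_card_Kclass; lia.
pose s1 := (Posz (s - 1)); pose t1 := Posz (t - 1).
have s1_gt0 : (0 < s1)%R by rewrite /s1; lia.
have t1_gt0 : (0 < t1)%R by rewrite /t1; lia.
have qE x : (q.[x] = x ^+ 4 - (s1 + t1 + 2) * x ^+ 3
    - (3 * (s1 + t1) + 8 * s1 * t1) * x ^+ 2
    + (s1 + t1 + 2 * s1 * t1) * x + s1 * t1)%R.
  have := horner_char_P4 (fun l => (fibre_card kc l)%:R%R) x.
  rewrite /= !wK /= !muln0 !muln1 !addn0 !add0n => ->.
  by rewrite /s1 /t1 !natz; ring.
(* This makes 4 the exact number of nonzero eigenvalues and gives their product a positive sign. *)
have q0 : (0 < q.[0])%R by rewrite qE /=; have := mulr_gt0 s1_gt0 t1_gt0; lia.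
have As : ((adist_mx e)^T = adist_mx e)%R.
  by apply/matrixP => x y; rewrite !mxE adist_sym.
have [m5 m4 m0] := int_minors As (lt0r_neq0 q0) chiq.
have m4' (f : 'I_4 -> 'I_(s + t)) : (0 <= \det (mxsub f f (adist_mx e)))%R.
  by have := m4 f; rewrite -signr_odd mul1r pmulr_rge0.
have [M base [c [csurj cE]]] :=
  blowup_of_minors simp conn (fun f : 'I_5 -> _ => m5 5 f isT) m4' m0.
have AE : adist_mx e = (\matrix_(x, y) int_mx M (c x) (c y))%R.
  by apply/matrixP => x y; rewrite [LHS]mxE [RHS]mxE cE.
(* Both graphs are blow-ups of matrices of size 4 on the same number of vertices, so the powers of
   ['X] cancel. *)
have EM : char_poly (int_mx M *m diag_mx (\row_l (fibre_card c l)%:R))%R = q.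
  apply: (mulfI (x := ('X^(s + t))%R)); first by rewrite expf_neq0 ?polyX_eq0.
  by rewrite -(char_poly_blowup (int_mx M) c) -AE chiq.
pose w k : int := fibre_card c k.
have w_gt0 k : k < 4 -> (0 < w k)%R.
  move=> k4; have [x xk] := csurj (Ordinal k4); rewrite /w ltz_nat.
  by apply/card_gt0P; exists x; rewrite inE xk.
have [w0 w1 w2 w3] := And4 (w_gt0 0 isT) (w_gt0 1 isT) (w_gt0 2 isT) (w_gt0 3 isT).
have hM x : (char_poly (int_mx M *m diag_mx (\row_l w l))%R).[x]%R = q.[x]%R.
  rewrite -EM; congr (char_poly (_ *m diag_mx _)).[x]%R.
  by apply/rowP => l; rewrite !mxE natz.
move: base cE hM; rewrite !inE => /or3P[] /eqP-> cE hM.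
- have E x := etrans (esym (horner_char_P4 w x)) (etrans (hM x) (qE x)).
  have [E1 E2 E3 E4] := quartic_coef E.
  have [wb wc wad] := P4_spectrum_weights w0 w1 w2 w3 s1_gt0 t1_gt0 E1 E2 E3 E4.
  apply: (P4_blowup_iso hs ht (c := c)) => [x y|||].
  - rewrite (adist_eq1 simp conn); congr (_ && _).
    have max1 k : (maxn 1 k == 1) = (k <= 1) by lia.
    by have := cE x y; rewrite int_mx_P4 => -[->]; rewrite max1.
  - by apply/eqP; rewrite -eqz_nat; apply/eqP.
  - by apply/eqP; rewrite -eqz_nat; apply/eqP.
  by case: wad => -[/eqP wa /eqP wd]; [left|right]; split;
     apply/eqP; rewrite -eqz_nat.
- have E x := etrans (esym (horner_char_K13 w x)) (etrans (hM x) (qE x)).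
  have [_ E2 _ E4] := quartic_coef E.
  by case: (K13_spectrum_absurd w0 w1 w2 w3 s1_gt0 t1_gt0 E2 E4).
have E x := etrans (esym (horner_char_C4 w x)) (etrans (hM x) (qE x)).
have [_ E2 _ E4] := quartic_coef E.
by case: (C4_spectrum_absurd w0 w1 w2 w3 s1_gt0 t1_gt0 E2 E4).
Qed.
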